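(* Let $A = \bigoplus_{k=-n}^n A_k$ be a $\mathbb{Z}$-graded semiprime right faithful associative algebra such that $A = \mathrm{id}(A_{-n})$ and $A = A_0AA_0$. Then there exists a complete system of orthogonal idempotents $\{e_0, \ldots, e_n\} \subseteq Q_s(A)$ inducing the grading of $A$, and hence inducing a grading on $Q_s(A)$, in such a way that $A_k \subseteq Q_s(A)_k$ for $k = 0, \ldots, n$.
   Context: All algebras are algebras over a fixed associative and commutative ring $\Phi$; associative algebras are not assumed to be unital. Products of submodules denote the $\Phi$-span of the products of elements. $\mathrm{id}(X)$ denotes the two-sided ideal of $A$ generated by $X$. $A$ is right faithful if $Ax = 0$ with $x\in A$ implies $x = 0$. A grading $A = \bigoplus_{k=-n}^n A_k$ is a decomposition into $\Phi$-submodules with $A_kA_l \subseteq A_{k+l}$ (where $A_m=0$ for $|m|>n$). For a semiprime associative algebra $A$, $Q^l_{max}(A)$ denotes the maximal left quotient algebra of $A$, and $Q_s(A)$ denotes the Martindale symmetric algebra of quotients of $A$, i.e. the set of all $q \in Q^l_{max}(A)$ for which there is an essential ideal $I$ of $A$ with $Iq + qI \subseteq A$; it is unital and contains $A$. For a graded algebra $A = \bigoplus_{k=-n}^n A_k$ put $H_i := A_iA_{-n}A_{n-i}$ and $H_{ij} := H_iAH_j$ for $i,j \in \{0,\ldots,n\}$. Let $S$ be a unital algebra containing $A$ as a subalgebra. A family $\{e_0,\ldots,e_n\}$ of orthogonal idempotents of $S$ is complete if $\sum_{i=0}^n e_i = 1$. The grading of $A$ is said to be induced by the complete system $\{e_0,\ldots,e_n\}$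 of orthogonal idempotents of $S$ if $H_{ij} = e_iAe_j$ for all $i,j$. (For $n=1$, with $e=e_1$, this means $A_{-1}=(1-e)Ae$, $A_0=eAe\oplus(1-e)A(1-e)$, $A_1=eA(1-e)$.) The grading on $Q_s(A)$ induced by $\{e_0,\ldots,e_n\} \subseteq Q_s(A)$ is $Q_s(A)_k = \bigoplus_{i-j=k} e_iQ_s(A)e_j$ for $-n\le k\le n$. *)

(* Defs.v *)
From HB Require Import structures.
From mathcomp Require Import all_boot all_order all_algebra.
From mathcomp Require Import boolp classical_sets.

Set Implicit Arguments.
Unset Strict Implicit.
Unset Printing Implicit Defensive.

Import GRing.Theory.
Local Open Scope classical_set_scope.
Local Open Scope ring_scope.

Reserved Notation "x ** y" (at level 40, left associativity).
Reserved Notation "X *s* Y" (at level 40, left associativity).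

(* MathComp's [algType] is unital and nonzero; associative algebras here need
   not have a unit and may be zero. *)
HB.mixin Record Lmodule_isAssocAlgebra (R : comPzRingType) V
    of GRing.Lmodule R V := {
  amul : V -> V -> V;
  amulA : associative amul;
  amulDl : forall x y z : V, amul (x + y) z = amul x z + amul y z;
  amulDr : forall x y z : V, amul x (y + z) = amul x y + amul x z;
  amulZl : forall (c : R) (x y : V), amul (c *: x) y = c *: amul x y;
  amulZr : forall (c : R) (x y : V), amul x (c *: y) = c *: amul x y
}.

#[short(type="assocAlgType")]
HB.structure Definition AssocAlgebra (R : comPzRingType) :=
  {V of Lmodule_isAssocAlgebra R V & GRing.Lmodule R V}.

Notation "x ** y" := (amul x y) : ring_scope.

Section Algebra.
Context (Phi : comPzRingType) (A : assocAlgType Phi).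
Implicit Types (X Y I J N B : set A) (G : int -> set A).

Definition submodule N :=
  N 0 /\ forall (c : Phi) (x y : A), N x -> N y -> N (c *: x + y).

Definition setprod X Y : set A :=
  smallest submodule [set x ** y | x in X & y in Y].

Definition ideal I :=
  submodule I /\ forall a x, I x -> I (a ** x) /\ I (x ** a).

Definition ideal_gen X : set A := smallest ideal X.

Definition semiprime :=
  forall I, ideal I -> (forall x y, I x -> I y -> x ** y = 0) -> I = [set 0].

Definition right_faithful := forall x : A, (forall a, a ** x = 0) -> x = 0.

Definition essential_ideal I :=
  ideal I /\ forall J, ideal J -> I `&` J = [set 0] -> J = [set 0].

(* The (2n+1)-grading is for a subset [B] of the ambient algebra ([setT] for the
   algebra itself). The components are indexed by all integers and vanish
   outside [-n, n]; the index [k] in [-n, n] is written [i - n], 0 <= i <= 2n. *)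
Definition grading (n : nat) B G :=
  [/\ forall k, submodule (G k),
      forall k, (n < `|k|)%N -> G k = [set 0],
      B = [set x | exists2 c : int -> A, forall k, G k (c k) &
                     x = \sum_(i < n.*2.+1) c (i%:Z - n%:Z)],
      forall c : int -> A, (forall k, G k (c k)) ->
        \sum_(i < n.*2.+1) c (i%:Z - n%:Z) = 0 -> forall k, c k = 0 &
      forall k l x y, G k x -> G l y -> G (k + l) (x ** y)].

Definition unity (u : A) := forall x, u ** x = x /\ x ** u = x.

Definition complete_orthogonal_idempotents (n : nat) (e : 'I_n.+1 -> A) :=
  [/\ forall i, e i ** e i = e i,
      forall i j, i != j -> e i ** e j = 0 &
      unity (\sum_i e i)].

Definition corner B (n : nat) (e : 'I_n.+1 -> A) (i j : 'I_n.+1) : set A :=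
  [set e i ** b ** e j | b in B].

Definition idem_component B (n : nat) (e : 'I_n.+1 -> A) (k : int) : set A :=
  [set x | exists2 c : 'I_n.+1 -> 'I_n.+1 -> A,
     forall i j, corner B e i j (c i j) &
     x = \sum_(i < n.+1) \sum_(j < n.+1 | i%:Z - j%:Z == k) c i j].

Definition gradH (n : nat) G (i : 'I_n.+1) : set A :=
  setprod (setprod (G i%:Z) (G (- n%:Z))) (G (n%:Z - i%:Z)).

Definition gradHH (n : nat) G (i j : 'I_n.+1) : set A :=
  setprod (setprod (gradH G i) setT) (gradH G j).

End Algebra.

Notation "X *s* Y" := (setprod X Y) : classical_set_scope.

Section Quotients.
Context (Phi : comPzRingType) (A : assocAlgType Phi).

Definition alg_embedding (B Q : assocAlgType Phi) (f : {linear B -> Q}) :=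
  {morph f : x y / x ** y} /\ injective f.

Definition left_quotient_algebra (Q : assocAlgType Phi)
    (iota : {linear A -> Q}) :=
  alg_embedding iota /\
  forall p q : Q, p <> 0 ->
    exists2 a : A, iota a ** p <> 0 & range iota (iota a ** q).

(* Utumi: every left quotient algebra of A embeds over A in the maximal one. *)
Definition maximal_left_quotient_algebra (Q : assocAlgType Phi)
    (iota : {linear A -> Q}) :=
  left_quotient_algebra iota /\
  forall (B : assocAlgType Phi) (j : {linear A -> B}),
    left_quotient_algebra j ->
    exists2 f : {linear B -> Q}, alg_embedding f & forall a, f (j a) = iota a.

(* For [iota] the inclusion of A in its maximal left quotient algebra, this is
   Q_s(A). *)
Definition martindale_symmetric (Q : assocAlgType Phi) (iota : {linear A -> Q})
    : set Q :=
  [set q | exists2 I : set A, essential_ideal I &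
     forall x, I x -> range iota (iota x ** q) /\ range iota (q ** iota x)].

Definition induces_grading (S : assocAlgType Phi) (iota : {linear A -> S})
    (n : nat) (G : int -> set A) (e : 'I_n.+1 -> S) :=
  forall i j : 'I_n.+1, iota @` gradHH G i j = corner (range iota) e i j.

End Quotients.

(* Main.v *)
Require Import Defs.
From HB Require Import structures.
From mathcomp Require Import all_boot all_order all_algebra.
From mathcomp Require Import boolp classical_sets functions.
From mathcomp Require Import zify.
Import GRing.Theory.
Local Open Scope classical_set_scope.
Local Open Scope ring_scope.

Set Implicit Arguments.
Unset Strict Implicit.
Unset Printing Implicit Defensive.

(** Write [H_i = A_i A_{-n} A_{n-i}]. In a product [b u b'] with [b] and [b'] of
degree [- n], a homogeneous [u] must have degree exactly [n], otherwise [b u b']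
or [u] itself leaves the range of the grading. Applied to the middle of
[H_i H_j] and [H_i A_k H_j], this yields [H_i H_j = 0] for [i <> j] and
[H_i A_k H_j = 0] for [k <> i - j] ([gradH_orthogonal], [gradH_sandwich_eq0]).
On the other hand [A = A_0 A A_0] is idempotent, so [A = id(A_{-n})] is spanned
by the [A_k A_{-n} A_l], whose part of degree 0 is the sum of the [H_i]. Hence
[A_0] is the sum of the [H_i] ([homogeneous_gradH]) and [A] is the sum of the
[H_i A H_j] ([gradHH_sum]).

Because [A] is faithful on both sides, an element killed by all the [H_i], on
either side, is zero. Together with the orthogonality this makes [A] the direct
sum of the [A H_i] and of the [H_i A]; the two projections attached to an index
[i] satisfy [x (l_i a) = (r_i x) a] ([peirce_multipliers]). So [r_i] and [l_i]
ought to be the right and left multiplications by one element [e_i].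

Such an [e_i] exists in [Q]: the endomorphisms of the left module [A], acting on
the right, form a left quotient algebra of [A] ([left_endo_quotient]), which
embeds in the maximal one, and [e_i] is the image of [r_i]. It satisfies
[A e_i + e_i A <= A], so it belongs to the symmetric quotient algebra with [A]
itself as the denominator ideal. The identities between the projections become
identities between the [e_i], and [e_i A e_j = r_j (l_i A) = H_i A H_j].

The grading of the symmetric quotient algebra is the Peirce decomposition of any
subalgebra containing a complete system of orthogonal idempotents
([peirce_grading]). Finally, for [a] in [A_k] and [k <> i - j], the corner
[e_i a e_j] vanishes since [H_i A_k H_j = 0]. *)

(** * Non-unital algebras and spans of products *)

Section AlgebraFacts.
Context {Phi : comPzRingType} {A : assocAlgType Phi}.
Implicit Types (x y z : A) (X Y Z N I J : set A).

Lemma amul0l x : 0 ** x = 0.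
Proof. by have := amulZl 0 0 x; rewrite !scale0r. Qed.

Lemma amul0r x : x ** 0 = 0.
Proof. by have := amulZr 0 x 0; rewrite !scale0r. Qed.

Lemma amulBl x y z : (x - y) ** z = x ** z - y ** z.
Proof. by rewrite -scaleN1r amulDl amulZl scaleN1r. Qed.

Lemma amulBr x y z : z ** (x - y) = z ** x - z ** y.
Proof. by rewrite -scaleN1r amulDr amulZr scaleN1r. Qed.

Lemma amul_suml (T : Type) (r : seq T) (P : pred T) (F : T -> A) x :
  (\sum_(i <- r | P i) F i) ** x = \sum_(i <- r | P i) F i ** x.
Proof. exact: (big_morph (amul^~ x) (fun y z => amulDl y z x) (amul0l x)). Qed.

Lemma amul_sumr (T : Type) (r : seq T) (P : pred T) (F : T -> A) x :
  x ** (\sum_(i <- r | P i) F i) = \sum_(i <- r | P i) x ** F i.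
Proof. exact: (big_morph (amul x) (amulDr x) (amul0r x)). Qed.

Lemma submoduleD N x y : submodule N -> N x -> N y -> N (x + y).
Proof. by move=> [_ N1] Nx Ny; rewrite -[x]scale1r; apply: N1. Qed.

Lemma submodule_sum N (T : Type) (r : seq T) (P : pred T) (F : T -> A) :
  submodule N -> (forall i, P i -> N (F i)) -> N (\sum_(i <- r | P i) F i).
Proof.
move=> sN NF; elim/big_ind : _ => //; first by case: sN.
by move=> x y; apply: submoduleD.
Qed.

Lemma submodule_smallest X : submodule (smallest (@submodule Phi A) X).
Proof.
split; first by move=> N [[N0 _] _].
move=> c x y Sx Sy N [sN XN]; have [_ N1] := sN.
by apply: N1; [apply: Sx|apply: Sy].
Qed.

Lemma mem_setprod X Y x y : X x -> Y y -> (X *s* Y) (x ** y).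
Proof. by move=> Xx Yy; apply: sub_gen_smallest; exists x => //; exists y. Qed.

Lemma setprod_sub X Y N : submodule N ->
  (forall x y, X x -> Y y -> N (x ** y)) -> X *s* Y `<=` N.
Proof.
by move=> sN XYN; apply: smallest_sub => // _ [x Xx [y Yy <-]]; apply: XYN.
Qed.

Lemma setprod3_sub X Y Z N : submodule N ->
  (forall x y z, X x -> Y y -> Z z -> N (x ** y ** z)) ->
  X *s* Y *s* Z `<=` N.
Proof.
move=> sN XYZN; apply: setprod_sub => // u z XYu Zz; move: u XYu.
apply: (setprod_sub (N := [set u | N (u ** z)])) => [|x y Xx Yy]; last first.
  exact: XYZN.
have [N0 N1] := sN; split=> [|c u v Nu Nv] /=; first by rewrite amul0l.
by rewrite amulDl amulZl; apply: N1.
Qed.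

(** With this lemma and the next, annihilation by a product of submodules need
only be checked on the generating products. *)
Lemma submodule_lann y : submodule [set x | x ** y = 0].
Proof.
split=> [|c u v /= u0 v0]; first exact: amul0l.
by rewrite amulDl amulZl u0 v0 scaler0 addr0.
Qed.

Lemma submodule_rann x : submodule [set y | x ** y = 0].
Proof.
split=> [|c u v /= u0 v0]; first exact: amul0r.
by rewrite amulDr amulZr u0 v0 scaler0 addr0.
Qed.

(** The left annihilator of [A] is an ideal of square zero. *)
Lemma semiprime_left_faithful :
  semiprime A -> forall x, (forall a, x ** a = 0) -> x = 0.
Proof.
move=> spA x x0; have : [set y : A | forall a, y ** a = 0] x by [].
rewrite (spA [set y | forall a, y ** a = 0]) => [//||y z y0 _]; last exact: y0.
split=> [|a y y0]; last by split=> b /=; rewrite -amulA ?y0 ?amul0r.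
split=> [a|c y z y0 z0 a]; first exact: amul0l.
by rewrite amulDl amulZl y0 z0 scaler0 addr0.
Qed.

End AlgebraFacts.

(** * Endomorphisms of the left regular module *)

Section LeftModuleEndomorphisms.
Context (Phi : comPzRingType) (A : assocAlgType Phi).

Definition left_endo_pred : {pred A -> A} := [pred f | `[<
  (forall (c : Phi) x y, f (c *: x + y) = c *: f x + f y) /\
  forall a x, f (a ** x) = a ** f x >]].

Fact left_endo_closed : submod_closed left_endo_pred.
Proof.
split=> [|c f g /asboolP[fL fM] /asboolP[gL gM]]; apply/asboolP.
  split=> [c x y|a x]; first by rewrite scaler0 addr0.
  by rewrite amul0r.
have combE x : (c *: f + g) x = c *: f x + g x by [].
split=> [d x y|a x]; rewrite !combE ?fM ?gM ?amulDr ?amulZr //.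
by rewrite fL gL !scalerDr !scalerA mulrC -!addrA; congr (_ + _); rewrite addrCA.
Qed.

HB.instance Definition _ :=
  GRing.isSubmodClosed.Build Phi (A -> A) left_endo_pred left_endo_closed.

Inductive left_endo : predArgType :=
  LeftEndo (f : A -> A) & f \in left_endo_pred.

Definition left_endo_fun (u : left_endo) := let: LeftEndo f _ := u in f.
Coercion left_endo_fun : left_endo >-> Funclass.

HB.instance Definition _ := [isSub of left_endo for left_endo_fun].
HB.instance Definition _ := [Choice of left_endo by <:].
HB.instance Definition _ := [SubChoice_isSubZmodule of left_endo by <:].
HB.instance Definition _ := [SubZmodule_isSubLmodule of left_endo by <:].

Implicit Types u v w : left_endo.

Lemma left_endoL u (c : Phi) x y : u (c *: x + y) = c *: u x + u y.
Proof. by case: u => f /= /asboolP[fL _]. Qed.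

Lemma left_endoM u a x : u (a ** x) = a ** u x.
Proof. by case: u => f /= /asboolP[_ fM]. Qed.

Lemma left_endoP u v : u =1 v -> u = v.
Proof. by move=> uv; apply/val_inj/funext. Qed.

Fact left_endo_mul_subproof u v : (fun x => v (u x)) \in left_endo_pred.
Proof.
by apply/asboolP; split=> [c x y|a x]; rewrite !(left_endoL, left_endoM).
Qed.

(** Endomorphisms are composed from left to right, as befits operators written on
the right; this makes [right_mult] multiplicative. *)
Definition left_endo_mul u v := LeftEndo (left_endo_mul_subproof u v).

Fact left_endo_mulA : associative left_endo_mul.
Proof. by move=> u v w; apply: left_endoP. Qed.

Fact left_endo_mulDl u v w :
  left_endo_mul (u + v) w = left_endo_mul u w + left_endo_mul v w.
Proof.
apply: left_endoP => x /=.
by have := left_endoL w 1 (u x) (v x); rewrite !scale1r.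
Qed.

Fact left_endo_mulDr u v w :
  left_endo_mul u (v + w) = left_endo_mul u v + left_endo_mul u w.
Proof. exact: left_endoP. Qed.

Fact left_endo_mulZl (c : Phi) u v :
  left_endo_mul (c *: u) v = c *: left_endo_mul u v.
Proof.
apply: left_endoP => x /=.
have v0 : v 0 = 0 by have := left_endoM v 0 0; rewrite !amul0l.
by have := left_endoL v c (u x) 0; rewrite v0 !addr0.
Qed.

Fact left_endo_mulZr (c : Phi) u v :
  left_endo_mul u (c *: v) = c *: left_endo_mul u v.
Proof. exact: left_endoP. Qed.

HB.instance Definition _ := Lmodule_isAssocAlgebra.Build Phi left_endo
  left_endo_mulA left_endo_mulDl left_endo_mulDr left_endo_mulZl left_endo_mulZr.

Lemma left_endo_amulE u v x : (u ** v) x = v (u x).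
Proof. by []. Qed.

Fact right_mult_subproof a : (fun x : A => x ** a) \in left_endo_pred.
Proof.
by apply/asboolP; split=> [c x y|b x]; rewrite ?amulDl ?amulZl ?amulA.
Qed.

Definition right_mult a := LeftEndo (right_mult_subproof a).

Fact right_mult_linear : linear right_mult.
Proof. by move=> c a b; apply: left_endoP => x /=; rewrite amulDr amulZr. Qed.

HB.instance Definition _ :=
  GRing.isLinear.Build Phi A left_endo _ right_mult right_mult_linear.

Lemma right_mult_amul a u : right_mult a ** u = right_mult (u a).
Proof. by apply: left_endoP => x; rewrite left_endo_amulE /= left_endoM. Qed.

Lemma left_endo_neq0 u : u <> 0 -> exists x, u x <> 0.
Proof.
move=> u0; apply: contrapT => /forallNP ux0; apply/u0/left_endoP => x.
exact: contrapT (ux0 x).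
Qed.

(** Since [right_mult a ** u = right_mult (u a)], multiplying by any element of
[A] brings every endomorphism into [A], and an [a] with [u a <> 0] keeps [u]
nonzero. *)
Lemma left_endo_quotient :
  right_faithful A -> left_quotient_algebra right_mult.
Proof.
move=> rfA; split; last first.
  move=> p q /left_endo_neq0[a pa0].
  exists a; rewrite right_mult_amul; last by exists (q a).
  move=> pa; apply: pa0; apply: rfA => x.
  exact: (congr1 (fun u : left_endo => u x) pa).
split=> [a b|a b ab]; first by rewrite right_mult_amul.
apply/eqP; rewrite -subr_eq0; apply/eqP; apply: rfA => x.
rewrite amulBr; apply/eqP; rewrite subr_eq0; apply/eqP.
exact: (congr1 (fun u : left_endo => u x) ab).
Qed.

End LeftModuleEndomorphisms.

(** * Essential ideals of semiprime algebras *)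

Section Ideals.
Context (Phi : comPzRingType) (A : assocAlgType Phi).
Implicit Types (N I J L : set A).

Lemma submodule_premul N a : submodule N -> submodule [set x | N (a ** x)].
Proof.
move=> [N0 N1]; split=> [|c x y Nx Ny] /=; first by rewrite amul0r.
by rewrite amulDr amulZr; apply: N1.
Qed.

Lemma submodule_postmul N a : submodule N -> submodule [set x | N (x ** a)].
Proof.
move=> [N0 N1]; split=> [|c x y Nx Ny] /=; first by rewrite amul0l.
by rewrite amulDl amulZl; apply: N1.
Qed.

Lemma idealI I J : ideal I -> ideal J -> ideal (I `&` J).
Proof.
move=> [[I0 I1] iI] [[J0 J1] iJ]; split; first split=> //.
  by move=> c x y [Ix Jx] [Iy Jy]; split; [apply: I1|apply: J1].
by move=> a x [Ix Jx]; have [? ?] := iI a x Ix; have [? ?] := iJ a x Jx.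
Qed.

Lemma ideal_setprod I J : ideal I -> ideal J -> ideal (J *s* I).
Proof.
move=> [sI iI] [sJ iJ]; have sJI := submodule_smallest
  [set x ** y | x in J & y in I].
split=> // a x JIx; split; move: x JIx; apply: setprod_sub.
- exact: submodule_premul.
- move=> y z Jy Iz /=; rewrite amulA; apply: mem_setprod => //.
  by case: (iJ a y Jy).
- exact: submodule_postmul.
- move=> y z Jy Iz /=; rewrite -amulA; apply: mem_setprod => //.
  by case: (iI a z Iz).
Qed.

Lemma ideal_setT : ideal [set: A].
Proof. by []. Qed.

Lemma essential_ideal_setT : essential_ideal [set: A].
Proof. by split; [exact: ideal_setT|move=> J _; rewrite setTI]. Qed.

(** If [L] meets [J I] trivially, then the intersection of [I], [J] and [L] has
square zero, so semiprimeness kills it; essentiality of [I] and then of [J] gives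
[L = 0]. *)
Lemma essential_ideal_setprod I J : semiprime A ->
  essential_ideal I -> essential_ideal J -> essential_ideal (J *s* I).
Proof.
move=> spA [iI eI] [iJ eJ]; split=> [|L iL JIL0]; first exact: ideal_setprod.
apply: eJ => //; apply: eI; first exact: idealI.
apply: spA => [|x y [_ [Jx Lx]] [Iy _]].
  by apply: idealI => //; apply: idealI.
have : (J *s* I `&` L) (x ** y).
  by split; [exact: mem_setprod|case: (iL.2 y x Lx)].
by rewrite JIL0.
Qed.

End Ideals.

(** * Left quotient algebras and the symmetric quotient algebra *)

Section LeftQuotients.
Context (Phi : comPzRingType) (A Q : assocAlgType Phi) (iota : {linear A -> Q}).
Hypothesis lqQ : left_quotient_algebra iota.
Implicit Types (a b x : A) (p q u : Q).

Lemma left_quotientM : {morph iota : x y / x ** y}.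
Proof. by case: lqQ => -[]. Qed.

(** [A] is dense enough in [Q] for identities to be tested after multiplication
by [A] on the left. *)
Lemma left_quotient_eq p q : (forall a, iota a ** p = iota a ** q) -> p = q.
Proof.
move=> pq; apply/eqP; rewrite -subr_eq0; apply/eqP; apply: contrapT => pq0.
have [a apq0 _] := lqQ.2 _ 0 pq0.
by apply: apq0; rewrite amulBr pq subrr.
Qed.

(** To get [q u = q], multiply [q u - q] by an [a] for which [a q] is in [A]. *)
Lemma left_quotient_unity u :
  (forall a, iota a ** u = iota a) -> unity u.
Proof.
move=> au q; split.
  by apply: left_quotient_eq => a; rewrite amulA au.
apply/eqP; rewrite -subr_eq0; apply/eqP; apply: contrapT => qu0.
have [a aqu0 [b _ ab]] := lqQ.2 _ q qu0.
by apply: aqu0; rewrite amulBr amulA -ab au subrr.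
Qed.

(** This submodule need not be an ideal, so a denominator ideal of [r] has to be
exhibited inside it. *)
Let regular r : set A :=
  [set x | range iota (iota x ** r) /\ range iota (r ** iota x)].

Let range_submodule : submodule (range iota).
Proof.
split=> [|c _ _ [a _ <-] [b _ <-]]; first by exists 0; rewrite ?linear0.
by exists (c *: a + b); rewrite ?linearP.
Qed.

Let regular_submodule r : submodule (regular r).
Proof.
have [S0 S1] := range_submodule.
split=> [|c x y [xr rx] [yr ry]]; first by split; rewrite linear0 ?amul0l ?amul0r.
by split; rewrite linearP ?amulDl ?amulDr ?amulZl ?amulZr; apply: S1.
Qed.

(** If [I p + p I <= A] and [J q + q J <= A], then [J I] serves for [p q]:
[J (I p)] lies in [J A <= J] and [(q J) I] in [A I <= I]. *)
Lemma martindale_amul p q : semiprime A -> martindale_symmetric iota p ->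
  martindale_symmetric iota q -> martindale_symmetric iota (p ** q).
Proof.
move=> spA [I eI Ip] [J eJ Jq].
exists (J *s* I); first exact: essential_ideal_setprod.
apply: setprod_sub (regular_submodule _) _ => y x Jy Ix.
have [[[_ iI] _] [[_ iJ] _]] := (eI, eJ).
have [[[a _ axp] _] [_ [b _ bqy]]] := (Ip x Ix, Jq y Jy).
split.
  rewrite left_quotientM -amulA [iota x ** _]amulA -axp amulA -left_quotientM.
  by have [] := Jq _ (iJ a y Jy).2.
rewrite left_quotientM amulA -[p ** q ** _]amulA -bqy -amulA -left_quotientM.
by have [] := Ip _ (iI b x Ix).1.
Qed.

(** The same [J I] serves for linear combinations, being inside [I] and [J]. *)
Lemma martindale_submodule : semiprime A ->
  submodule (martindale_symmetric iota).
Proof.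
move=> spA; split=> [|c p q [I eI Ip] [J eJ Jq]].
  exists setT => [|x _]; first exact: essential_ideal_setT.
  by rewrite amul0l amul0r; split; exists 0; rewrite ?linear0.
exists (J *s* I); first exact: essential_ideal_setprod.
apply: setprod_sub (regular_submodule _) _ => y x Jy Ix.
have [[[_ iI] _] [[_ iJ] _]] := (eI, eJ); have [_ S1] := range_submodule.
have [[xp px] [xq qx]] := (Ip _ (iI y x Ix).1, Jq _ (iJ x y Jy).2).
by split; rewrite ?amulDl ?amulDr ?amulZl ?amulZr; apply: S1.
Qed.

End LeftQuotients.

(** * The grading induced by a complete system of idempotents *)

Section PeirceDecomposition.
Context (Phi : comPzRingType) (Q : assocAlgType Phi) (n : nat).
Context (e : 'I_n.+1 -> Q) (B : set Q).
Hypothesis ce : complete_orthogonal_idempotents e.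
Hypothesis sB : submodule B.
Hypothesis BM : forall p q, B p -> B q -> B (p ** q).
Hypothesis Be : forall i, B (e i).
Implicit Types (p q x : Q) (i j : 'I_n.+1).

Lemma idempotent_mul i j : e i ** e j = if i == j then e i else 0.
Proof.
by have [eM eO _] := ce; case: eqVneq => [->|/eO].
Qed.

Lemma peirce_sum x : x = \sum_i \sum_j e i ** x ** e j.
Proof.
have [_ _ u] := ce; rewrite -[LHS](u x).1 -[LHS](u _).2 amul_suml amul_suml.
by apply: eq_bigr => i _; rewrite amul_sumr.
Qed.

Lemma peirce_eq p q : (forall i j, e i ** p ** e j = e i ** q ** e j) -> p = q.
Proof.
move=> pq; rewrite [p]peirce_sum [q]peirce_sum.
by do 2!apply: eq_bigr => ? _; apply: pq.
Qed.

Lemma peirce_corner i j k l x :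
  e k ** (e i ** x ** e j) ** e l =
  if (k == i) && (j == l) then e i ** x ** e j else 0.
Proof.
rewrite !amulA idempotent_mul -!amulA idempotent_mul.
case: eqVneq => [->|_] /=; last by rewrite amul0l.
by case: eqVneq => [->|_]; rewrite ?amul0r ?amulA.
Qed.

(** A description by equations, in place of a choice of corners: the grading
properties become verifications on the corners of given elements. *)
Lemma idem_componentP k x : idem_component B e k x <->
  B x /\ forall i j, i%:Z - j%:Z != k -> e i ** x ** e j = 0.
Proof.
split=> [[c ec ->]|[Bx x0]].
  split.
    apply: submodule_sum => // i _; apply: submodule_sum => // j _.
    by have [b Bb <-] := ec i j; apply: BM => //; apply: BM.
  move=> i j ijk; rewrite amul_sumr amul_suml big1 // => k' _.
  rewrite amul_sumr amul_suml big1 // => l' /eqP klk.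
  have [b _ <-] := ec k' l'; rewrite peirce_corner.
  by case: eqVneq => //= ik; case: eqVneq => // jl; rewrite ik -jl klk eqxx in ijk.
exists (fun i j => e i ** x ** e j) => [i j|]; first by exists x.
rewrite [LHS]peirce_sum; apply: eq_bigr => i _.
rewrite (bigID (fun j : 'I_n.+1 => i%:Z - j%:Z == k)) /= [X in _ + X]big1 ?addr0 //.
by move=> j; apply: x0.
Qed.

Let diagonal k x := \sum_(i < n.+1) \sum_(j < n.+1 | i%:Z - j%:Z == k)
  e i ** x ** e j.

Let diagonal_component k x : B x -> idem_component B e k (diagonal k x).
Proof. by move=> Bx; exists (fun i j => e i ** x ** e j) => // i j; exists x. Qed.

Let diagonal_corner k x i j : B x ->
  e i ** diagonal k x ** e j = if i%:Z - j%:Z == k then e i ** x ** e j else 0.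
Proof.
move=> Bx; have [_ d0] := (idem_componentP _ _).1 (diagonal_component k Bx).
case: ifP => [ijk|/negbT/d0 //].
rewrite /diagonal amul_sumr amul_suml (bigD1 i) //= [X in _ + X]big1 ?addr0.
  rewrite amul_sumr amul_suml (bigD1 j) //= [X in _ + X]big1 ?addr0.
    by rewrite peirce_corner !eqxx.
  by move=> l /andP[_ lj]; rewrite peirce_corner (negPf lj) andbF.
move=> l li; rewrite amul_sumr amul_suml big1 // => m _.
by rewrite peirce_corner eq_sym (negPf li).
Qed.

(* Degrees [i - j] are counted from [- n], hence the index [i - j + n]. *)
Let degree_index i j : {k : 'I_n.*2.+1 | i%:Z - j%:Z = k%:Z - n%:Z}.
Proof.
have kP : (i + n - j < n.*2.+1)%N by have := ltn_ord i; lia.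
by exists (Ordinal kP) => /=; have := ltn_ord j; lia.
Qed.

(** A homogeneous family is recovered from its sum: the corner [(i, j)] of the
sum is the corner of the only member of degree [i - j]. *)
Let sum_corner (c : int -> Q) i j : (forall k, idem_component B e k (c k)) ->
  e i ** (\sum_(k < n.*2.+1) c (k%:Z - n%:Z)) ** e j =
  e i ** c (i%:Z - j%:Z) ** e j.
Proof.
move=> cP; have [k ijk] := degree_index i j.
rewrite amul_sumr amul_suml (bigD1 k) //= ijk big1 ?addr0 // => l lk.
apply: ((idem_componentP _ _).1 (cP _)).2; apply: contra lk => /eqP kl.
by apply/eqP/val_inj => /=; lia.
Qed.

(** Families with given sum are compared corner by corner with [sum_corner]; for
products, the unit [\sum_m e_m] is inserted between the factors, and
[(i - m) + (m - j) = i - j]. *)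
Lemma peirce_grading : grading n B (idem_component B e).
Proof.
have [B0 B1] := sB; split.
- move=> k; split=> [|c x y /idem_componentP[Bx x0] /idem_componentP[By y0]].
    by apply/idem_componentP; split=> // i j _; rewrite amul0r amul0l.
  apply/idem_componentP; split=> [|i j ijk]; first exact: B1.
  by rewrite amulDr amulDl amulZr amulZl x0 // y0 // scaler0 addr0.
- move=> k nk; apply/seteqP; split=> [x /idem_componentP[_ x0]|_ ->] /=.
    apply: peirce_eq => i j; rewrite x0 ?amul0r ?amul0l //.
    by have := ltn_ord i; have := ltn_ord j; lia.
  by apply/idem_componentP; split=> // i j _; rewrite amul0r amul0l.
- apply/seteqP; split=> [x Bx|_ [c cP ->]] /=; last first.
    by apply: submodule_sum => // k _; case/idem_componentP: (cP (k%:Z - n%:Z)).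
  exists (diagonal^~ x) => [k|]; first exact: diagonal_component.
  apply: peirce_eq => i j.
  rewrite (sum_corner (c := diagonal^~ x)) => [|k]; last exact: diagonal_component.
  by rewrite diagonal_corner ?eqxx.
- move=> c cP c0 k; apply: peirce_eq => i j; rewrite amul0r amul0l.
  have [<-|ijk] := eqVneq (i%:Z - j%:Z) k; last first.
    exact: ((idem_componentP _ _).1 (cP k)).2.
  by rewrite -sum_corner // c0 amul0r amul0l.
- move=> k l x y /idem_componentP[Bx x0] /idem_componentP[By y0].
  apply/idem_componentP; split=> [|i j ijkl]; first exact: BM.
  have [eM _ u] := ce; rewrite -[x](u x).2 amul_sumr amul_suml amul_sumr amul_suml.
  rewrite big1 // => m _; rewrite -[e m]eM !amulA -!amulA [e m ** (y ** _)]amulA.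
  have [imk|imk] := eqVneq (i%:Z - m%:Z) k.
    by rewrite y0 ?amul0r //; apply: contra ijkl => /eqP mjl; apply/eqP; lia.
  by rewrite !amulA x0 // !amul0l.
Qed.

End PeirceDecomposition.

(** * Peirce decomposition of the graded algebra *)

Section GradedAlgebra.
Context (Phi : comPzRingType) (A : assocAlgType Phi) (n : nat).
Context (G : int -> set A).
Hypothesis grA : grading n [set: A] G.
Implicit Types (a b c h x y z : A) (k l m : int) (i j : 'I_n.+1).

Local Notation H := (gradH (n := n) G).

Let G_submodule k : submodule (G k).
Proof. by case: grA. Qed.

Let G_out k x : G k x -> (n < `|k|)%N -> x = 0.
Proof. by case: grA => _ G0 _ _ _ Gx nk; move: Gx; rewrite G0. Qed.

Let G_mul k l m x y : G k x -> G l y -> m = k + l -> G m (x ** y).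
Proof. by case: grA => _ _ _ _ GM Gx Gy ->; apply: GM. Qed.

(** If [m > n] then [u = 0]; if [m < n] then the product has degree
[m - 2n < - n]. *)
Lemma sandwich_eq0 m b u b' :
  G (- n%:Z) b -> G m u -> G (- n%:Z) b' -> m != n%:Z -> b ** u ** b' = 0.
Proof.
move=> Gb Gu Gb' mn; have [nm|nm] := ltnP n `|m|.
  by rewrite (G_out Gu nm) amul0r amul0l.
apply: (@G_out (- n%:Z + m - n%:Z)); last by lia.
by apply: G_mul Gb' _; [apply: G_mul Gb Gu _|].
Qed.

(** Here and in the next lemma, the middle factors from [A_{n-i}] to [A_j] are
sandwiched between two factors in [A_{-n}]. *)
Lemma gradH_sandwich_eq0 k i j h x h' :
  k != i%:Z - j%:Z -> H i h -> G k x -> H j h' -> h ** x ** h' = 0.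
Proof.
move=> kij Hh Gx Hh'.
apply: (setprod3_sub (submodule_rann (h ** x)) _ Hh') => a' b' c' Ga' Gb' Gc'.
rewrite /= -amulA.
apply: (setprod3_sub (submodule_lann (x ** (a' ** b' ** c'))) _ Hh).
move=> a b c Ga Gb Gc /=.
rewrite (_ : _ ** _ = a ** (b ** (c ** x ** a') ** b') ** c'); last first.
  by rewrite !amulA.
rewrite (sandwich_eq0 Gb _ Gb' (m := n%:Z - i%:Z + k + j%:Z)) ?amul0r ?amul0l //.
  by apply: G_mul (erefl _) => //; apply: G_mul (erefl _).
by apply: contra kij; lia.
Qed.

Lemma gradH_orthogonal i j h h' : i != j -> H i h -> H j h' -> h ** h' = 0.
Proof.
move=> ij Hh Hh'.
apply: (setprod3_sub (submodule_rann h) _ Hh') => a' b' c' Ga' Gb' Gc' /=.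
apply: (setprod3_sub (submodule_lann (a' ** b' ** c')) _ Hh).
move=> a b c Ga Gb Gc /=.
rewrite (_ : _ ** _ = a ** (b ** (c ** a') ** b') ** c'); last first.
  by rewrite !amulA.
rewrite (sandwich_eq0 Gb _ Gb' (m := n%:Z - i%:Z + j%:Z)) ?amul0r ?amul0l //.
  by apply: G_mul (erefl _).
by apply: contra ij => /eqP ij; apply/eqP/val_inj => /=; lia.
Qed.

Lemma gradHH_mull_eq0 i j (k : 'I_n.+1) h x :
  gradHH G i j x -> H k h -> k != i -> h ** x = 0.
Proof.
move=> HHx Hh ki; apply: (setprod3_sub (submodule_rann h) _ HHx).
by move=> u a v Hu _ _ /=; rewrite !amulA (gradH_orthogonal ki Hh Hu) !amul0l.
Qed.

Lemma gradHH_mulr_eq0 i j (k : 'I_n.+1) h x :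
  gradHH G i j x -> H k h -> k != j -> x ** h = 0.
Proof.
rewrite eq_sym => HHx Hh jk; apply: (setprod3_sub (submodule_lann h) _ HHx).
by move=> u a v _ _ Hv /=; rewrite -!amulA (gradH_orthogonal jk Hv Hh) !amul0r.
Qed.

Let graded_eq (c c' : int -> A) : (forall k, G k (c k)) ->
  (forall k, G k (c' k)) ->
  \sum_(i < n.*2.+1) c (i%:Z - n%:Z) = \sum_(i < n.*2.+1) c' (i%:Z - n%:Z) ->
  c =1 c'.
Proof.
case: grA => _ _ _ G0 _ Gc Gc' cc' k; apply/eqP; rewrite -subr_eq0; apply/eqP.
move: k; apply: G0 => [k|]; last by rewrite sumrB cc' subrr.
have [_ G1] := G_submodule k.
by rewrite -[c k](scale1r) addrC -scaleN1r; apply: G1; rewrite ?scale1r.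
Qed.

Let graded_sum x :
  exists2 c, (forall k, G k (c k)) & x = \sum_(i < n.*2.+1) c (i%:Z - n%:Z).
Proof.
by case: grA => _ _ AE _ _; have : [set: A] x by []; rewrite AE.
Qed.

Let homogeneous_family l x (k : int) := if k == l then x else 0.

Let homogeneous_familyP l x : G l x -> forall k, G k (homogeneous_family l x k).
Proof.
move=> Gx k; rewrite /homogeneous_family; case: eqP => [->//|_].
by case: (G_submodule k).
Qed.

Let homogeneous_sum l x : G l x ->
  x = \sum_(i < n.*2.+1) homogeneous_family l x (i%:Z - n%:Z).
Proof.
move=> Gx; have [nl|ln] := ltnP n `|l|.
  by rewrite (G_out Gx nl) big1 // => i _; rewrite /homogeneous_family if_same.
have lP : (`|(l + n%:Z)%R| < n.*2.+1)%N by lia.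
rewrite (bigD1 (Ordinal lP)) //= [X in _ + X]big1 ?addr0 => [|i il].
  by rewrite /homogeneous_family ifT //; lia.
rewrite /homogeneous_family ifF //; apply: contraNF il => /eqP il.
by apply/eqP/val_inj => /=; lia.
Qed.

Hypothesis genA : [set: A] = ideal_gen (G (- n%:Z)).
Hypothesis A0A : [set: A] = G 0 *s* [set: A] *s* G 0.

(** As [A = A_0 A A_0] is idempotent, the ideal generated by [A_{-n}] is spanned
by the [A_k A_{-n} A_l], with no terms lacking a factor on one side. *)
Lemma homogeneous_span (N : set A) : submodule N ->
  (forall k l a b c, G k a -> G (- n%:Z) b -> G l c -> N (a ** b ** c)) ->
  forall x, N x.
Proof.
move=> sN NG.
have Nabc a b c : G (- n%:Z) b -> N (a ** b ** c).
  move=> Gb; have [ca Ga ->] := graded_sum a; have [cc Gc ->] := graded_sum c.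
  rewrite amul_suml amul_suml; apply: submodule_sum => // i _.
  by rewrite amul_sumr; apply: submodule_sum => // j _; apply: NG.
have Nall x a c : N (a ** x ** c).
  have : [set: A] x by [].
  rewrite genA => /(_ [set x | forall a c, N (a ** x ** c)]); apply.
  split=> [|b Gb a' c' /=]; last exact: Nabc.
  have [N0 N1] := sN; split; first split.
  - by move=> a' c'; rewrite amul0r amul0l.
  - move=> d u v Nu Nv a' c'.
    by rewrite amulDr amulZr amulDl amulZl; apply: N1.
  - move=> b u Nu; split=> a' c'; first by rewrite amulA.
    by rewrite amulA -amulA.
move=> x; have : [set: A] x by [].
by rewrite A0A; apply: setprod3_sub => // a b c _ _ _.
Qed.

(** A nonzero product from [A_k A_{-n} A_l] has degree 0 exactly when [k + l = n];
then [k] and [l] are between 0 and [n], so it lies in [H_k]. Hence the component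
of degree 0 of every element is a sum of elements of the [H_i]. *)
Lemma homogeneous_gradH g : G 0 g ->
  exists2 c : 'I_n.+1 -> A, (forall i, H i (c i)) & g = \sum_i c i.
Proof.
move=> Gg.
pose S : set A := [set x |
  exists2 c : 'I_n.+1 -> A, (forall i, H i (c i)) & x = \sum_i c i].
have sH i : submodule (H i) by apply: submodule_smallest.
have sS : submodule S.
  split; first by exists (fun=> 0) => [i|]; [case: (sH i)|rewrite big1].
  move=> d _ _ [c Hc ->] [c' Hc' ->].
  exists (fun i => d *: c i + c' i) => [i|]; first by case: (sH i) => _; apply.
  by rewrite big_split scaler_sumr.
have [c Gc [gE Sc]] : (exists2 c, forall k, G k (c k) &
    g = \sum_(i < n.*2.+1) c (i%:Z - n%:Z) /\ S (c 0)).
  move: g {Gg}; apply: homogeneous_span.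
    split.
      exists (fun=> 0) => [k|]; first by case: (G_submodule k).
      by split; [rewrite big1|case: sS].
    move=> d _ _ [c Gc [-> Sc]] [c' Gc' [-> Sc']].
    exists (fun k => d *: c k + c' k) => [k|].
      by case: (G_submodule k) => _; apply.
    by split; [rewrite big_split scaler_sumr|case: sS => _; apply].
  move=> k l a b c Ga Gb Gc.
  have Gabc : G (k - n%:Z + l) (a ** b ** c).
    by apply: G_mul (erefl _) => //; apply: G_mul (erefl _).
  exists (homogeneous_family (k - n%:Z + l) (a ** b ** c)).
    exact: homogeneous_familyP.
  split; first exact: homogeneous_sum.
  have S0 : S 0 by case: sS.
  rewrite /homogeneous_family; case: eqP => // kl.
  have [nk|kn] := ltnP n `|k|; first by rewrite (G_out Ga nk) !amul0l.
  have [nl|ln] := ltnP n `|l|; first by rewrite (G_out Gc nl) !amul0r.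
  have kP : (`|k| < n.+1)%N by lia.
  exists (fun i => if i == Ordinal kP then a ** b ** c else 0) => [i|].
    case: eqP => [->|_]; last by case: (sH i).
    apply: mem_setprod; first apply: mem_setprod => //.
      by rewrite (_ : _%:Z = k) //=; lia.
    by rewrite (_ : _ - _ = l) //=; lia.
  by rewrite -big_mkcond big_pred1_eq.
suff -> : g = c 0 by [].
have := graded_eq Gc (homogeneous_familyP Gg).
rewrite -gE -homogeneous_sum // => /(_ erefl 0) ->.
by rewrite /homogeneous_family eqxx.
Qed.

(** Expand both factors [A_0] of [A = A_0 A A_0]. *)
Lemma gradHH_sum x : exists2 c : 'I_n.+1 -> 'I_n.+1 -> A,
  (forall i j, gradHH G i j (c i j)) & x = \sum_i \sum_j c i j.
Proof.
have sHH i j : submodule (gradHH G i j) by apply: submodule_smallest.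
pose S : set A := [set x | exists2 c : 'I_n.+1 -> 'I_n.+1 -> A,
  (forall i j, gradHH G i j (c i j)) & x = \sum_i \sum_j c i j].
suff : [set: A] `<=` S by apply.
rewrite {1}A0A; apply: setprod3_sub.
  split.
    exists (fun _ _ => 0) => [i j|]; first by case: (sHH i j).
    by rewrite big1 // => i _; rewrite big1.
  move=> d _ _ [c Hc ->] [c' Hc' ->].
  exists (fun i j => d *: c i j + c' i j) => [i j|].
    by case: (sHH i j) => _; apply.
  rewrite scaler_sumr -big_split; apply: eq_bigr => i _.
  by rewrite scaler_sumr -big_split.
move=> g a g' /homogeneous_gradH[c Hc ->] _ /homogeneous_gradH[c' Hc' ->].
exists (fun i j => c i ** a ** c' j) => [i j|].
  by apply: mem_setprod => //; apply: mem_setprod.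
rewrite !amul_suml; apply: eq_bigr => i _.
by rewrite amul_sumr.
Qed.

Hypothesis spA : semiprime A.
Hypothesis rfA : right_faithful A.

(** [A_0] is the sum of the [H_i], so what the [H_i] annihilate is annihilated by
[A_0 A A_0 = A]. *)
Lemma gradH_right_faithful y : (forall i h, H i h -> h ** y = 0) -> y = 0.
Proof.
move=> Hy; have G0y g : G 0 g -> g ** y = 0.
  move=> /homogeneous_gradH[c Hc ->]; rewrite amul_suml big1 // => i _.
  exact: Hy (Hc i).
apply: rfA => a; have : [set: A] a by [].
rewrite A0A; apply: (setprod3_sub (submodule_lann y)) => g b g' _ _ Gg' /=.
by rewrite -amulA G0y ?amul0r.
Qed.

Lemma gradH_left_faithful y : (forall i h, H i h -> y ** h = 0) -> y = 0.
Proof.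
move=> Hy; have G0y g : G 0 g -> y ** g = 0.
  move=> /homogeneous_gradH[c Hc ->]; rewrite amul_sumr big1 // => i _.
  exact: Hy (Hc i).
apply: (semiprime_left_faithful spA) => a; have : [set: A] a by [].
rewrite A0A; apply: (setprod3_sub (submodule_rann y)) => g b g' Gg _ _ /=.
by rewrite !amulA G0y ?amul0l.
Qed.

(** The [H_i] stand in for idempotents, which need not exist in [A]: equalities
can be tested corner by corner all the same. *)
Lemma gradH_faithful y z :
  (forall i j h h', H i h -> H j h' -> h ** y ** h' = h ** z ** h') -> y = z.
Proof.
move=> yz; apply/eqP; rewrite -subr_eq0; apply/eqP.
apply: gradH_right_faithful => i h Hh; apply: gradH_left_faithful => j h' Hh'.
by rewrite amulBr amulBl (yz i j) ?subrr.
Qed.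

(** The candidates for the idempotents, as multipliers of [A]: [r i] and [l i]
project along the decompositions of [A] into the [A H_i] and the [H_i A], and
they are linked by [x (l_i a) = (r_i x) a], which makes them the right and left
multiplications by a single element [e_i] of a larger algebra. *)
Lemma peirce_multipliers : exists (r : 'I_n.+1 -> left_endo A)
    (l : 'I_n.+1 -> A -> A),
  [/\ forall i a x, x ** l i a = r i x ** a,
      forall i j x, r j (r i x) = if i == j then r i x else 0,
      forall x, \sum_i r i x = x,
      forall i j, gradHH G i j = [set r j (l i x) | x in [set: A]] &
      forall i j k x, k != i%:Z - j%:Z -> G k x -> r j (l i x) = 0].
Proof.
have /boolp.choice[c cP] : forall x, exists c : 'I_n.+1 -> 'I_n.+1 -> A,
    (forall i j, gradHH G i j (c i j)) /\ x = \sum_i \sum_j c i j.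
  by move=> x; have [c Hc xE] := gradHH_sum x; exists c.
pose l i x := \sum_j c x i j; pose r0 j x := \sum_i c x i j.
(* By the faithfulness lemmas, [lE] and [rE] characterize [l] and [r0], which is
   how linearity and the identities below are obtained from mere choices [c]. *)
have lE i j h x : H j h -> h ** l i x = if j == i then h ** x else 0.
  have [Hc xE] := cP x => Hh.
  have c0 i' : i' != j -> h ** l i' x = 0.
    rewrite eq_sym => ji'; rewrite amul_sumr big1 // => j' _.
    exact: gradHH_mull_eq0 (Hc i' j') Hh ji'.
  case: eqVneq => [<-|]; last by rewrite eq_sym => /c0.
  rewrite {2}xE [RHS]amul_sumr [RHS](bigD1 j) //=.
  by rewrite [X in _ = _ + X]big1 ?addr0.
have rE i j h x : H j h -> r0 i x ** h = if j == i then x ** h else 0.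
  have [Hc xE] := cP x => Hh.
  have c0 i' : i' != j -> r0 i' x ** h = 0.
    rewrite eq_sym => ji'; rewrite amul_suml big1 // => j' _.
    exact: gradHH_mulr_eq0 (Hc j' i') Hh ji'.
  case: eqVneq => [<-|]; last by rewrite eq_sym => /c0.
  rewrite {2}xE exchange_big [RHS]amul_suml [RHS](bigD1 j) //=.
  by rewrite [X in _ = _ + X]big1 ?addr0.
have r0P i : r0 i \in @left_endo_pred Phi A.
  apply/asboolP; split=> [d x y|a x]; apply/eqP; rewrite -subr_eq0; apply/eqP;
    apply: gradH_left_faithful => j h Hh; rewrite amulBl.
    rewrite amulDl amulZl !(rE _ _ _ _ Hh).
    case: ifP; rewrite ?amulDl ?amulZl ?subrr //.
    by rewrite scaler0 addr0 subrr.
  by rewrite -amulA !(rE _ _ _ _ Hh); case: ifP; rewrite ?amulA ?amul0r subrr.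
pose r i : left_endo A := LeftEndo (r0P i).
exists r, l; split.
(* Both sides are the sum of the [c x k i ** a]: under left multiplication, [l i a]
   agrees with [a] for [A H_i] and is killed by the other [A H_j]. *)
- move=> i a x; have [Hc xE] := cP x.
  rewrite [in LHS]xE amul_suml /= /r0 amul_suml; apply: eq_bigr => k _.
  have cE j : c x k j ** l i a = if j == i then c x k j ** a else 0.
    have [ji|ji] := eqVneq.
      apply/eqP; rewrite -subr_eq0 -amulBr; apply/eqP.
      apply: (setprod_sub (submodule_lann (l i a - a)) _ (Hc k j)) => u h _ Hh /=.
      by rewrite -amulA amulBr (lE _ _ _ _ Hh) ji eqxx subrr amul0r.
    apply: (setprod_sub (submodule_lann (l i a)) _ (Hc k j)) => u h _ Hh /=.
    by rewrite -amulA (lE _ _ _ _ Hh) (negPf ji) amul0r.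
  rewrite amul_suml (bigD1 i) //= [X in _ + X]big1 ?addr0 => [|j /negPf ji].
    by rewrite cE eqxx.
  by rewrite cE ji.
- move=> i j x /=; apply/eqP; rewrite -subr_eq0; apply/eqP.
  apply: gradH_left_faithful => k h Hh; rewrite amulBl (rE _ _ _ _ Hh).
  case: (eqVneq i j) => [->|ij].
    by rewrite !(rE _ _ _ _ Hh); case: eqP; rewrite subrr.
  rewrite amul0l subr0 (rE _ _ _ _ Hh); case: eqP => // ->.
  by rewrite eq_sym (negPf ij).
- by move=> x; have [_ ->] := cP x; rewrite exchange_big; have [_ {1}<-] := cP x.
- move=> i j; apply/seteqP; split=> [x HHx|_ [x _ <-]].
    exists x => //; apply: gradH_faithful => k m h h' Hh Hh' /=.
    rewrite -[in LHS]amulA (rE _ _ _ _ Hh'); case: eqVneq => [mj|mj]; last first.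
      by rewrite amul0r -[RHS]amulA (gradHH_mulr_eq0 HHx Hh') ?amul0r.
    rewrite amulA (lE _ _ _ _ Hh); case: eqVneq => // ki.
    by rewrite (gradHH_mull_eq0 HHx Hh).
  have [Hc xE] := cP x; suff -> : r j (l i x) = c x i j by [].
  apply: gradH_faithful => k m h h' Hh Hh' /=.
  rewrite -[in LHS]amulA (rE _ _ _ _ Hh'); case: eqVneq => [mj|mj]; last first.
    by rewrite amul0r -[RHS]amulA (gradHH_mulr_eq0 (Hc i j) Hh') ?amul0r.
  rewrite amulA; case: (eqVneq k i) => [ki|ki]; last first.
    by rewrite (lE _ _ _ _ Hh) (negPf ki) (gradHH_mull_eq0 (Hc i j) Hh).
  rewrite -!amulA; congr (_ ** _); rewrite amul_suml (bigD1 j) //=.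
  rewrite big1 ?addr0 // => j' jj'.
  by apply: gradHH_mulr_eq0 (Hc i j') Hh' _; rewrite mj eq_sym.
- move=> i j k x kij Gx; apply: gradH_faithful => i' j' h h' Hh Hh' /=.
  rewrite amul0r amul0l -amulA (rE _ _ _ _ Hh').
  case: eqVneq => [jE|]; last by rewrite amul0r.
  rewrite amulA (lE _ _ _ _ Hh); case: eqVneq => [iE|]; last by rewrite amul0l.
  by move: Hh Hh'; rewrite iE jE => Hh Hh'; apply: gradH_sandwich_eq0 kij Hh Gx Hh'.
Qed.

End GradedAlgebra.

(** * The idempotents in the maximal left quotient algebra *)

Theorem proposition2p3 (Phi : comPzRingType) (A : assocAlgType Phi) (n : nat)
    (G : int -> set A)
    (Q : assocAlgType Phi) (iota : {linear A -> Q})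
    (grA : grading n setT G)
    (spA : semiprime A)
    (rfA : right_faithful A)
    (genA : setT = ideal_gen (G (- n%:Z)))
    (A0A : setT = G 0 *s* setT *s* G 0)
    (maxQ : maximal_left_quotient_algebra iota) :
  exists e : 'I_n.+1 -> Q,
    [/\ forall i, martindale_symmetric iota (e i),
        complete_orthogonal_idempotents e,
        induces_grading iota G e,
        grading n (martindale_symmetric iota)
          (idem_component (martindale_symmetric iota) e) &
        forall k : nat, (k <= n)%N ->
          iota @` G k%:Z `<=` idem_component (martindale_symmetric iota) e k%:Z].
Proof.
have [lqQ maxQu] := maxQ.
have [r [l [rl rr r1 HHE HH0]]] := peirce_multipliers grA genA A0A spA rfA.
have [f [fM _] fE] := maxQu _ _ (left_endo_quotient rfA).
have iotaM := left_quotientM lqQ.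
pose e i := f (r i).
have iota_e a i : iota a ** e i = iota (r i a).
  by rewrite -fE -fM right_mult_amul fE.
have e_iota a i : e i ** iota a = iota (l i a).
  rewrite -fE -fM -fE; congr (f _); apply: left_endoP => x.
  by rewrite left_endo_amulE /= rl.
have corner_iota i j a : e i ** iota a ** e j = iota (r j (l i a)).
  by rewrite e_iota iota_e.
have Qe i : martindale_symmetric iota (e i).
  exists setT => [|x _]; first exact: essential_ideal_setT.
  by rewrite iota_e e_iota; split; eexists.
have ce : complete_orthogonal_idempotents e.
  have eM i j : e i ** e j = if i == j then e i else 0.
    apply: (left_quotient_eq lqQ) => a; rewrite amulA !iota_e rr.
    by case: eqP; rewrite ?iota_e ?linear0 ?amul0r.
  split=> [i|i j /negPf ij|]; rewrite ?eM ?eqxx ?ij //.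
  apply: (left_quotient_unity lqQ) => a.
  rewrite amul_sumr -[in RHS](r1 a) linear_sum.
  by apply: eq_bigr => i _; apply: iota_e.
have Qiota a : martindale_symmetric iota (iota a).
  exists setT => [|x _]; first exact: essential_ideal_setT.
  by rewrite -!iotaM; split; eexists.
have sQ := martindale_submodule iota spA.
have QM p q := @martindale_amul _ _ _ _ lqQ p q spA.
exists e; split=> //.
- move=> i j; rewrite HHE; apply/seteqP.
  split=> [_ [_ [a _ <-] <-]|_ [_ [a _ <-] <-]].
    by exists (iota a); [exists a|rewrite corner_iota].
  by exists (r j (l i a)); [exists a|rewrite corner_iota].
- exact: peirce_grading.
move=> k kn _ [x Gx <-]; apply/idem_componentP => //.
split=> // i j ijk; rewrite corner_iota (HH0 i j k%:Z) ?linear0 //.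
by rewrite eq_sym.
Qed.
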